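(* Let $(X,\{R_i\}_{i=0}^{3})$ be a primitive $Q$-polynomial association scheme with $3$ classes. Then there exists $i\in\{1,2,3\}$ such that the intersection matrix $L_i=(p_{ij}^k)_{k,j=0}^{3}$ has $4$ distinct eigenvalues.
   Context: A (symmetric) association scheme with $D$ classes is a pair $(X,\{R_i\}_{i=0}^D)$ where $X$ is a finite set and $R_0,\dots,R_D$ are non-empty subsets of $X\times X$ whose adjacency matrices $A_0,\dots,A_D$ satisfy: $A_0=I$, $\sum_{i=0}^D A_i=J$ (all-ones matrix), $A_i^\top=A_i$, and $A_iA_j=\sum_{k=0}^D p_{ij}^kA_k$ for nonnegative integers $p_{ij}^k$ (the intersection numbers). The real span of the $A_i$ is a commutative algebra with a basis of primitive idempotents $E_0=\frac1{|X|}J,E_1,\dots,E_D$; it is closed under entrywise product $\circ$, and the Krein parameters $q_{ij}^k$ are defined by $E_i\circ E_j=\frac{1}{|X|}\sum_{k=0}^D q_{ij}^kE_k$. The scheme is $Q$-polynomial if, for some ordering $E_1,\dots,E_D$, the matrix $(q_{1j}^k)_{k,j=0}^D$ is tridiagonal with nonzero superdiagonal and subdiagonal entries (equivalently, $E_j=v_j^*(E_1)$ under entrywise multiplication for polynomials $v_j^*$ of degree $j$). The scheme is primitive if each of $A_1,\dots,A_D$ is the adjacency matrix of a connected graph. For each $i$, $L_i=(p_{ij}^k)_{k,j=0}^D$ is the $(D+1)\times(D+1)$ matrix with $(k,j)$-entry $p_{ij}^k$. *)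

(* Defs.v *)
From HB Require Import structures.
From mathcomp Require Import all_boot all_order all_algebra.
From mathcomp Require Import reals.

Set Implicit Arguments.
Unset Strict Implicit.
Unset Printing Implicit Defensive.

Import Order.TTheory GRing.Theory Num.Theory.
Local Open Scope ring_scope.

(* Rows and columns are indexed by X through the enumeration enum_val. *)
Definition adjmx (R : realType) (X : finType) (S : {set X * X}) : 'M[R]_#|X| :=
  \matrix_(x, y) ((enum_val x, enum_val y) \in S)%:R.

(* [scheme_p i j k] is the intersection number p_{ij}^k; it is determined by
   the relations, since the [adjmx] of the relations are linearly
   independent. *)
Record assoc_scheme (R : realType) (X : finType) (D : nat) := AssocScheme {
  scheme_rel : 'I_D.+1 -> {set X * X};
  scheme_p : 'I_D.+1 -> 'I_D.+1 -> 'I_D.+1 -> nat;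
  scheme_rel_neq0 : forall i, scheme_rel i != set0;
  scheme_adj0 : adjmx R (scheme_rel ord0) = 1%:M;
  scheme_adj_sum : \sum_i adjmx R (scheme_rel i) = const_mx 1;
  scheme_adj_tr : forall i,
    (adjmx R (scheme_rel i))^T = adjmx R (scheme_rel i);
  scheme_adjM : forall i j,
    adjmx R (scheme_rel i) *m adjmx R (scheme_rel j) =
    \sum_k (scheme_p i j k)%:R *: adjmx R (scheme_rel k)
}.

Section AssocScheme.

Variables (R : realType) (X : finType) (D : nat) (S : assoc_scheme R X D).

Definition scheme_adj (i : 'I_D.+1) : 'M[R]_#|X| := adjmx R (scheme_rel S i).

Definition primitive_scheme : Prop :=
  forall i : 'I_D.+1, i != ord0 ->
  forall x y : X, connect (fun u v => (u, v) \in scheme_rel S i) x y.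

Definition intersection_mx (i : 'I_D.+1) : 'M[R]_D.+1 :=
  \matrix_(k, j) (scheme_p S i j k)%:R.

Definition bose_mesner : {vspace 'M[R]_#|X|} :=
  <<[tuple scheme_adj i | i < D.+1]>>%VS.

Definition bm_idempotent (F : 'M[R]_#|X|) : Prop :=
  F \in bose_mesner /\ F *m F = F.

Definition bm_primitive_idempotent (F : 'M[R]_#|X|) : Prop :=
  [/\ bm_idempotent F, F != 0 &
      forall G H : 'M[R]_#|X|, bm_idempotent G -> bm_idempotent H ->
        G *m H = 0 -> H *m G = 0 -> F = G + H -> G = 0 \/ H = 0].

(* E lists the primitive idempotents of the Bose-Mesner algebra, in an order
   that starts with J / |X|. *)
Definition idempotent_ordering (E : 'I_D.+1 -> 'M[R]_#|X|) : Prop :=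
  [/\ E ord0 = #|X|%:R^-1 *: const_mx 1,
      forall i, bm_primitive_idempotent (E i) &
      basis_of bose_mesner [tuple E i | i < D.+1]].

(* [q i j k] is q_{ij}^k; [map2_mx *%R] is the entrywise product. *)
Definition krein_parameters (E : 'I_D.+1 -> 'M[R]_#|X|)
    (q : 'I_D.+1 -> 'I_D.+1 -> 'I_D.+1 -> R) : Prop :=
  forall i j, map2_mx *%R (E i) (E j) = #|X|%:R^-1 *: \sum_k q i j k *: E k.

(* [inord 1] is the index 1 as soon as D >= 1. *)
Definition Q_polynomial : Prop :=
  exists (E : 'I_D.+1 -> 'M[R]_#|X|)
         (q : 'I_D.+1 -> 'I_D.+1 -> 'I_D.+1 -> R),
  [/\ idempotent_ordering E,
      krein_parameters E q,
      forall k j : 'I_D.+1, (k.+1 < j)%N || (j.+1 < k)%N ->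
        q (inord 1) j k = 0 &
      forall k j : 'I_D.+1, (k.+1 == j :> nat) || (j.+1 == k :> nat) ->
        q (inord 1) j k != 0].

End AssocScheme.

Definition has_n_distinct_eigenvalues (R : realType) (m n : nat)
    (M : 'M[R]_m) : Prop :=
  exists s : seq R,
    [/\ uniq s, size s = n & forall a : R, eigenvalue M a = (a \in s)].

(* Main.v *)
Require Import Defs.
From HB Require Import structures.
From mathcomp Require Import all_boot all_order all_algebra.
From mathcomp Require Import reals ring.

Set Implicit Arguments.
Unset Strict Implicit.
Unset Printing Implicit Defensive.

Import Order.TTheory GRing.Theory Num.Theory.
Local Open Scope ring_scope.

(** Let [P l i] be the eigenvalue of [A_i] on [E_l]. Row [l] of [P] is a left
    eigenvector of [L_i] for [P l i], and primitivity makes [P 0 i] different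
    from the other [P l i], so it suffices to find [i] such that [P 1 i],
    [P 2 i], [P 3 i] are distinct.
    Suppose that there is none. If [P 2 i = P 3 i] for some [i != 0], then
    [A_i] is a combination of [J], [I] and [E_1], so [E_1] takes the same value
    on the two other nontrivial relations; by the Q-polynomial property so do
    all the [E_j], hence all matrices of the Bose-Mesner algebra, which is
    absurd. Otherwise, by pigeonhole, [P 1 i = P j i] for two indices [i] and
    the same [j]; as each row [l != 0] of [P] sums to [0], rows [1] and [j]
    of [P] coincide, which is absurd as well. *)

(** * Spans of tuples and eigenvalue counts *)

Lemma span_tupleP (K : fieldType) (V : vectType K) (n : nat) (f : 'I_n -> V)
    (v : V) :
  v \in <<[tuple f i | i < n]>>%VS -> exists c : 'I_n -> K,
    v = \sum_i c i *: f i.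
Proof.
move=> /coord_span ->; exists (fun i => coord [tuple f i | i < n] i v).
by apply: eq_bigr => i _; rewrite -tnth_nth tnth_mktuple.
Qed.

Lemma sum_span_tuple (K : fieldType) (V : vectType K) (n : nat)
    (f : 'I_n -> V) (c : 'I_n -> K) :
  \sum_i c i *: f i \in <<[tuple f i | i < n]>>%VS.
Proof.
apply: memv_suml => i _; apply/memvZ/memv_span.
by apply/tnthP; exists i; rewrite tnth_mktuple.
Qed.

(** The characteristic polynomial has degree [m], so one more eigenvalue would give it too many
    roots. *)
Lemma distinct_eigenvalues (R : realType) (m : nat) (M : 'M[R]_m)
    (s : seq R) :
  uniq s -> size s = m -> all (eigenvalue M) s ->
  has_n_distinct_eigenvalues m M.
Proof.
move=> us ss /allP es; exists s; split=> // a; apply/idP/idP => [ea|/es //].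
apply: contraT => na.
have nz : char_poly M != 0 by rewrite -size_poly_eq0 size_char_poly.
suff : (size (a :: s) < size (char_poly M))%N.
  by rewrite size_char_poly /= ss ltnn.
apply: max_poly_roots => //=; last by rewrite na us.
rewrite -eigenvalue_root_char ea; apply/allP => b /es.
by rewrite eigenvalue_root_char.
Qed.

(** * The Bose-Mesner algebra and its relations *)

Section Scheme.

Variables (R : realType) (X : finType) (D : nat) (S : assoc_scheme R X D).

Local Notation A := (scheme_adj S).

Lemma scheme_adj_bm i : A i \in bose_mesner S.
Proof. by apply: memv_span; apply/tnthP; exists i; rewrite tnth_mktuple. Qed.

Lemma bose_mesnerM F G : F \in bose_mesner S -> G \in bose_mesner S ->
  F *m G \in bose_mesner S.
Proof.
move=> /span_tupleP[c ->] /span_tupleP[d ->].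
rewrite mulmx_suml; apply: memv_suml => i _.
rewrite mulmx_sumr; apply: memv_suml => j _.
rewrite -scalemxAl -scalemxAr; do 2 apply: memvZ.
by rewrite /scheme_adj scheme_adjM; apply: sum_span_tuple.
Qed.

Lemma bose_mesner_tr F : F \in bose_mesner S -> F^T = F.
Proof.
move=> /span_tupleP[c ->]; rewrite linear_sum; apply: eq_bigr => i _ /=.
by rewrite linearZ /= /scheme_adj scheme_adj_tr.
Qed.

(** Members of the algebra are symmetric and [F *m G] is again a member, so it equals its transpose
    [G *m F]. *)
Lemma bose_mesnerC F G : F \in bose_mesner S -> G \in bose_mesner S ->
  F *m G = G *m F.
Proof.
move=> hF hG; rewrite -(bose_mesner_tr (bose_mesnerM hF hG)) trmx_mul.
by rewrite !bose_mesner_tr.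
Qed.

Lemma scheme_rel_ex i : exists x y : 'I_#|X|, A i x y = 1.
Proof.
have /set0Pn[[x y] hxy] := scheme_rel_neq0 S i.
by exists (enum_rank x), (enum_rank y); rewrite mxE !enum_rankK hxy.
Qed.

Lemma scheme_adj_ge0 i x y : 0 <= A i x y.
Proof. by rewrite mxE ler0n. Qed.

(** The entries at a given position are nonnegative and add up to 1, the entry of [J]. *)
Lemma scheme_adj_disj i j x y : i != j -> A i x y = 1 -> A j x y = 0.
Proof.
move=> nij hi; have := congr1 (fun M : 'M_ _ => M x y) (scheme_adj_sum S).
rewrite summxE mxE (bigD1 i) //= -/(scheme_adj S i) hi.
rewrite (bigD1 j) 1?eq_sym //= ; rewrite -[RHS]addr0 => /addrI h.
apply/eqP; rewrite eq_le scheme_adj_ge0 andbT -h lerDl.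
by apply: sumr_ge0 => k _; exact: scheme_adj_ge0.
Qed.

Lemma scheme_points_gt0 : (0 < #|X|)%N.
Proof. by have [x _] := scheme_rel_ex ord0; apply: leq_ltn_trans (ltn_ord x). Qed.

Lemma scheme_points_neq0 : #|X|%:R != 0 :> R.
Proof. by rewrite pnatr_eq0 -lt0n scheme_points_gt0. Qed.

(* Maximum principle: the set where [v] is maximal is closed under adjacency. *)
Lemma regular_connected_eigenvector i (v : 'cV[R]_#|X|) (k : R) :
  (forall x y : X, connect (fun u w => (u, w) \in scheme_rel S i) x y) ->
  (forall x, \sum_y A i x y = k) -> A i *m v = k *: v ->
  forall x y, v x 0 = v y 0.
Proof.
move=> hc hk hv.
pose x0 := Ordinal scheme_points_gt0.
case: (@Order.TotalTheory.arg_maxP _ _ 'I_#|X| x0 xpredT (fun x => v x 0)) => //.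
move=> m _ hm.
have step x y : v x 0 = v m 0 -> A i x y = 1 -> v y 0 = v m 0.
  move=> hx hxy; have := congr1 (fun M : 'cV_ _ => M x 0) hv.
  (* The eigenvalue equation at [x] becomes a vanishing sum of terms [A i x z * (v x 0 - v z 0)],
     all nonnegative since [v x 0] is maximal. *)
  rewrite !mxE -(hk x) mulr_suml => /eqP; rewrite eq_sym -subr_eq0 -sumrB.
  rewrite psumr_eq0 => [|z _]; last first.
    by rewrite -mulrBr mulr_ge0 ?scheme_adj_ge0 // subr_ge0 hx; apply: hm.
  move=> /allP/(_ y (mem_index_enum _)) /=; rewrite hxy !mul1r subr_eq0.
  by rewrite hx => /eqP.
suff all_max x : v x 0 = v m 0 by move=> x y; rewrite !all_max.
have /connectP[p hp] := hc (enum_val m) (enum_val x).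
have : v (enum_rank (enum_val m)) 0 = v m 0 by rewrite enum_valK.
move: (enum_val m) hp => z hp hz hl.
rewrite -(enum_valK x) hl; elim: p z hp hz {hl} => [|w p IH] z //=.
move=> /andP[hzw hp] hz; apply: (IH w hp); apply: (step _ _ hz).
by rewrite mxE !enum_rankK hzw.
Qed.

(** * Primitive idempotents and the eigenmatrix *)

Section Idempotents.

Variable E : 'I_D.+1 -> 'M[R]_#|X|.
Hypothesis hE : idempotent_ordering S E.

Lemma idem_mem l : E l \in bose_mesner S.
Proof. by case: hE => _ /(_ l)[[]]. Qed.

Lemma idemK l : E l *m E l = E l.
Proof. by case: hE => _ /(_ l)[[]]. Qed.

Lemma idem_neq0 l : E l != 0.
Proof. by case: hE => _ /(_ l)[]. Qed.

Lemma idem_inj l m : E l = E m -> l = m.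
Proof.
case: hE => _ _ /basis_free/free_uniq/tuple_uniqP hu hlm.
by apply: hu; rewrite !tnth_mktuple.
Qed.

(** [E l] splits into the orthogonal idempotents [E l *m E m] and [E l - E l *m E m]; primitivity
    kills one of them. *)
Lemma idem_absorb l m : E l *m E m = 0 \/ E l *m E m = E l.
Proof.
have [hl hm] := (idem_mem l, idem_mem m).
have hlm := bose_mesnerM hl hm.
have C := bose_mesnerC hl hm.
have hK : E l *m E m *m (E l *m E m) = E l *m E m.
  by rewrite {1}C mulmxA -(mulmxA (E m)) idemK -C -mulmxA idemK.
have hL : E l *m (E l *m E m) = E l *m E m by rewrite mulmxA idemK.
have hR : E l *m E m *m E l = E l *m E m by rewrite C -mulmxA idemK.
case: hE => _ /(_ l)[_ _ hp] _.
case: (hp (E l *m E m) (E l - E l *m E m)).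
- by split.
- split; first by rewrite rpredB.
  by rewrite mulmxBl !mulmxBr hK hL hR idemK subrr subr0.
- by rewrite mulmxBr hK hR subrr.
- by rewrite mulmxBl hK hL subrr.
- by rewrite addrC subrK.
- by left.
- by move/eqP; rewrite subr_eq0 => /eqP <-; right.
Qed.

(** If the product were nonzero, absorption on both sides would give [E l = E l *m E m = E m]. *)
Lemma idem_orth l m : l != m -> E l *m E m = 0.
Proof.
move=> nlm; case: (idem_absorb l m) => // hl.
case: (idem_absorb m l); rewrite -(bose_mesnerC (idem_mem l) (idem_mem m)) //.
by rewrite hl => /idem_inj /eqP; rewrite (negPf nlm).
Qed.

Lemma idem_expand F : F \in bose_mesner S ->
  exists c : 'I_D.+1 -> R, F = \sum_l c l *: E l.
Proof.
by case: hE => _ _ /span_basis hs hF; apply: span_tupleP; rewrite hs.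
Qed.

Lemma sum_idemM (c : 'I_D.+1 -> R) m :
  (\sum_l c l *: E l) *m E m = c m *: E m.
Proof.
rewrite mulmx_suml (bigD1 m) //= -scalemxAl idemK big1 ?addr0 // => l nlm.
by rewrite -scalemxAl idem_orth // scaler0.
Qed.

Lemma scaler_idem_inj l : injective (fun a : R => a *: E l).
Proof.
move=> a b /eqP; rewrite -subr_eq0 -scalerBl scaler_eq0 (negPf (idem_neq0 l)).
by rewrite orbF subr_eq0 => /eqP.
Qed.

Lemma sum_idem : \sum_l E l = 1%:M.
Proof.
have [c hc] : exists c : 'I_D.+1 -> R, 1%:M = \sum_l c l *: E l.
  by apply: idem_expand; rewrite -(scheme_adj0 S); exact: scheme_adj_bm.
rewrite hc; apply: eq_bigr => l _.
by rewrite -sum_idemM -hc mul1mx.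
Qed.

(** The first eigenmatrix of the scheme: rows are indexed by idempotents, columns by relations. *)
Definition eigenmatrix (l i : 'I_D.+1) : R :=
  coord [tuple E m | m < D.+1] l (A i).

Local Notation P := eigenmatrix.

Lemma scheme_adjE i : A i = \sum_l P l i *: E l.
Proof.
have hA : A i \in <<[tuple E m | m < D.+1]>>%VS.
  by case: hE => _ _ /span_basis ->; exact: scheme_adj_bm.
rewrite {1}(coord_span hA); apply: eq_bigr => l _.
by rewrite -tnth_nth tnth_mktuple.
Qed.

Lemma scheme_adj_idem i l : A i *m E l = P l i *: E l.
Proof. by rewrite scheme_adjE sum_idemM. Qed.

Lemma eigenmatrix0 l : P l ord0 = 1.
Proof.
apply: (@scaler_idem_inj l).
by rewrite -scheme_adj_idem /scheme_adj scheme_adj0 mul1mx scale1r.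
Qed.

Lemma const_mx1E : const_mx 1 = #|X|%:R *: E ord0.
Proof.
by case: hE => -> _ _; rewrite scalerA divff ?scale1r ?scheme_points_neq0.
Qed.

(** The [A i] add up to [J], a multiple of [E ord0], which annihilates [E l]. *)
Lemma eigenmatrix_row_sum l : l != ord0 -> \sum_i P l i = 0.
Proof.
move=> nl; apply: (@scaler_idem_inj l); rewrite scale0r scaler_suml.
under eq_bigr do rewrite -scheme_adj_idem.
rewrite -mulmx_suml /scheme_adj scheme_adj_sum const_mx1E -scalemxAl.
by rewrite idem_orth ?scaler0 // eq_sym.
Qed.

(** As a combination of the [A i], [E l] acts on each [E r] by a scalar determined by row [r] of
    [P]. This scalar is 1 for [r = l] and 0 for [r = m] if [l != m], so the two rows differ. *)
Lemma eigenmatrix_row_inj l m : (forall i, P l i = P m i) -> l = m.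
Proof.
move=> h; apply/eqP; apply: contraT => nlm.
have /span_tupleP[c hc] := idem_mem l.
have key r : E l *m E r = (\sum_i c i * P r i) *: E r.
  rewrite {1}hc mulmx_suml scaler_suml; apply: eq_bigr => i _.
  by rewrite -scalemxAl scheme_adj_idem scalerA.
have h1 : \sum_i c i * P l i = 1.
  by apply: (@scaler_idem_inj l); rewrite -key idemK scale1r.
have := key m; rewrite idem_orth // -(eq_bigr _ (fun i _ => congr1 _ (h i))).
by rewrite h1 scale1r => /esym/eqP; rewrite (negPf (idem_neq0 m)).
Qed.

(** Evaluating [A i *m A j *m E l] in two ways gives [P l i * P l j] as the sum of the [P l k]
    weighted by [p_{ij}^k]. Row [l] is nonzero since it starts with 1. *)
Lemma eigenvalue_intersection_mx i l :
  eigenvalue (intersection_mx S i) (P l i).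
Proof.
apply/eigenvalueP; exists (\row_j P l j); last first.
  apply/eqP => /rowP/(_ ord0); rewrite !mxE eigenmatrix0.
  exact/eqP/oner_neq0.
apply/rowP => j; rewrite !mxE; apply: (@scaler_idem_inj l) => /=.
rewrite mulrC -scalerA -scheme_adj_idem scalemxAr -scheme_adj_idem mulmxA.
rewrite /scheme_adj scheme_adjM mulmx_suml scaler_suml.
apply: eq_bigr => k _; rewrite !mxE -scalemxAl -/(scheme_adj S k).
by rewrite scheme_adj_idem scalerA mulrC.
Qed.

Lemma scheme_adj_row_sum i x : \sum_y A i x y = P ord0 i.
Proof.
have := congr1 (fun M : 'M_ _ => M x x) (scheme_adj_idem i ord0).
have [h0 _ _] := hE; rewrite h0 -scalemxAr !mxE.
under eq_bigr do rewrite [const_mx _ _ _]mxE mulr1.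
have nz := scheme_points_neq0.
by rewrite mulr1 [RHS]mulrC => /(mulfI (invr_neq0 nz)).
Qed.

(** In case of equality the columns of [E l] are eigenvectors of [A i] for its valency [P ord0 i],
    hence constant by connectedness. *)
Lemma eigenmatrix_primitive i l : primitive_scheme S -> i != ord0 ->
  l != ord0 -> P ord0 i != P l i.
Proof.
move=> hprim ni nl; apply/eqP => h.
have cst z x y : E l x z = E l y z.
  suff : col z (E l) x 0 = col z (E l) y 0 by rewrite !mxE.
  apply: (regular_connected_eigenvector (hprim i ni) (scheme_adj_row_sum i)).
  by rewrite colE mulmxA scheme_adj_idem h -scalemxAl.
(* [E ord0] averages each column, so it fixes the constant columns of [E l]; by orthogonality it
   also annihilates them. *)
have /eqP[] := idem_neq0 l; apply/matrixP => x z.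
have := congr1 (fun M : 'M_ _ => M x z) (idem_orth nl).
rewrite bose_mesnerC ?idem_mem //; have [-> _ _] := hE.
rewrite -scalemxAl !mxE; under eq_bigr do rewrite mxE mul1r (cst z _ x).
rewrite sumr_const card_ord -[X in _ * X]mulr_natl mulrA mulVf ?scheme_points_neq0 //.
by rewrite mul1r.
Qed.

(** * Consequences of the Q-polynomial property *)

Lemma idem0_entry x y x' y' : E ord0 x y = E ord0 x' y'.
Proof. by case: hE => -> _ _; rewrite !mxE. Qed.

(** By tridiagonality, the entrywise product of [E_1] and [E_{l-1}] is a combination of
    [E_0, ..., E_l] with a nonzero coefficient at [E_l]. Inductively, the value of [E_1] at a pair
    determines that of every [E_l]. *)
Lemma Q_polynomial_separates q x y x' y' :
  krein_parameters E q ->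
  (forall k j : 'I_D.+1, (k.+1 < j)%N || (j.+1 < k)%N ->
     q (inord 1) j k = 0) ->
  (forall k j : 'I_D.+1, (k.+1 == j :> nat) || (j.+1 == k :> nat) ->
     q (inord 1) j k != 0) ->
  E (inord 1) x y = E (inord 1) x' y' ->
  forall F, F \in bose_mesner S -> F x y = F x' y'.
Proof.
move=> hk h0 hn0 h1.
suff hall n (l : 'I_D.+1) : (l <= n)%N -> E l x y = E l x' y'.
  move=> F /idem_expand[c ->]; rewrite !summxE; apply: eq_bigr => l _.
  by rewrite mxE [RHS]mxE (hall l).
elim: n l => [|n IH] l.
  rewrite leqn0 => /eqP l0.
  have -> : l = ord0 by apply: val_inj.
  exact: idem0_entry.
rewrite leq_eqVlt => /predU1P[ln|]; last exact: IH.
have hn : (n < D.+1)%N by rewrite -ltnS -ln ltnS ltnW.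
pose m := Ordinal hn.
have expand u v : E (inord 1) u v * E m u v =
    #|X|%:R^-1 * (q (inord 1) m l * E l u v
      + \sum_(k < D.+1 | (k <= n)%N) q (inord 1) m k * E k u v).
  have := congr1 (fun M : 'M_ _ => M u v) (hk (inord 1) m).
  rewrite !mxE summxE => ->; congr (_ * _).
  rewrite (bigD1 l) //= mxE; congr (_ + _).
  rewrite [LHS](bigID (fun k : 'I_D.+1 => (k <= n)%N)) /= addrC big1 ?add0r.
    apply: eq_big => [k|k _]; last by rewrite mxE.
    by rewrite andbC; case: leqP => //= kn; apply: contraTneq kn => ->; rewrite ln ltnn.
  (* Here [k > n] and [k != l = n + 1], so [k] is at least [n + 2] and lies outside the three
     diagonals. *)
  move=> k /andP[nkl]; rewrite -ltnNge => nk; rewrite mxE h0 ?mul0r //.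
  apply/orP; right; rewrite /= ltn_neqAle nk andbT -ln.
  by rewrite eq_sym.
have old_terms : \sum_(k < D.+1 | (k <= n)%N) q (inord 1) m k * E k x y =
    \sum_(k < D.+1 | (k <= n)%N) q (inord 1) m k * E k x' y'.
  by apply: eq_bigr => k /IH ->.
have nz : q (inord 1) m l != 0 by rewrite hn0 //= ln eqxx orbT.
have := expand x y; rewrite h1 (IH m) // expand old_terms.
by move=> /(mulfI (invr_neq0 scheme_points_neq0))/addIr/(mulfI nz).
Qed.

End Idempotents.

End Scheme.

(** * Coinciding eigenvalues in schemes with three classes *)

Section ThreeClasses.

Variables (R : realType) (X : finType) (S : assoc_scheme R X 3).
Variable E : 'I_4 -> 'M[R]_#|X|.
Hypothesis hE : idempotent_ordering S E.

Local Notation A := (scheme_adj S).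
Local Notation P := (eigenmatrix S E).
Local Notation o1 := (@Ordinal 4 1 isT).
Local Notation o2 := (@Ordinal 4 2 isT).
Local Notation o3 := (@Ordinal 4 3 isT).

Lemma sum_ord4 (V : nmodType) (f : 'I_4 -> V) :
  \sum_i f i = f ord0 + (f o1 + (f o2 + f o3)).
Proof.
rewrite !big_ord_recl big_ord0 addr0.
by congr (f _ + (f _ + (f _ + f _))); apply/val_inj.
Qed.

(** Replacing [E_2 + E_3] by [I - E_0 - E_1] leaves [E_1] as the only term of [A i] that can differ
    between the two pairs: [E_0] is constant, and [h0] places both pairs on the diagonal or both off
    it. *)
Lemma eigenvalue_coincidence23 i x y x' y' : P o2 i = P o3 i ->
  A ord0 x y = A ord0 x' y' ->
  A i x y - A i x' y' = (P o1 i - P o2 i) * (E o1 x y - E o1 x' y').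
Proof.
move=> h23 h0.
have hA u v : A i u v = (P ord0 i - P o2 i) * E ord0 u v
    + (P o1 i - P o2 i) * E o1 u v + P o2 i * A ord0 u v.
  have -> : A ord0 u v = \sum_l E l u v.
    by rewrite /scheme_adj scheme_adj0 -(sum_idem hE) summxE.
  rewrite {1}(scheme_adjE hE i) summxE !sum_ord4 !mxE -h23.
  by ring.
by rewrite !hA h0 (idem0_entry hE x y x' y'); ring.
Qed.

Lemma nontrivial_others (i : 'I_4) : i != ord0 -> exists b c : 'I_4,
  [&& b != ord0, c != ord0, b != i, c != i & b != c].
Proof.
case: i => [[|[|[|[|//]]]]] hi // _.
- by exists o2, o3.
- by exists o1, o3.
- by exists o1, o2.
Qed.

Lemma eigenvalue_coincidence23_false q i :
  krein_parameters E q ->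
  (forall k j : 'I_4, (k.+1 < j)%N || (j.+1 < k)%N ->
     q (inord 1) j k = 0) ->
  (forall k j : 'I_4, (k.+1 == j :> nat) || (j.+1 == k :> nat) ->
     q (inord 1) j k != 0) ->
  i != ord0 -> P o2 i != P o3 i.
Proof.
move=> hk h0 hn0 ni; apply/eqP => h23.
have [b [c /and5P[nb nc nbi nci nbc]]] := nontrivial_others ni.
have [xi [yi hi]] := scheme_rel_ex S i.
have [xb [yb hb]] := scheme_rel_ex S b.
have [xc [yc hc]] := scheme_rel_ex S c.
have Ii := scheme_adj_disj ni hi.
have Ib := scheme_adj_disj nb hb.
have Ic := scheme_adj_disj nc hc.
have hib := eigenvalue_coincidence23 h23 (etrans Ii (esym Ib)).
have := eigenvalue_coincidence23 h23 (etrans Ib (esym Ic)).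
rewrite (scheme_adj_disj nbi hb) (scheme_adj_disj nci hc) subrr => /esym/eqP.
(* [A i] vanishes on both other relations [b] and [c]. If the factor [P o1 i - P o2 i] is zero,
   [A i] could not tell [i] from [b]; otherwise [E_1] agrees on [b] and [c], and then so does
   [A b]. *)
rewrite mulf_eq0 => /orP[] /eqP hz.
  move: hib; rewrite hz mul0r hi (scheme_adj_disj nbi hb) subr0.
  exact/eqP/oner_neq0.
have e1 : inord 1 = o1 by apply/val_inj; rewrite /= inordK.
have hbc : E (inord 1) xb yb = E (inord 1) xc yc.
  by rewrite e1; apply/eqP; rewrite -subr_eq0 hz.
have := Q_polynomial_separates hE hk h0 hn0 hbc (scheme_adj_bm S b).
rewrite hb (scheme_adj_disj _ hc) 1?eq_sym //.
exact/eqP/oner_neq0.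
Qed.

(** Rows [l] and [m] also agree at index 0, where both are 1. A second coincidence would leave a
    single index, where the zero row sums force agreement too, making the rows equal. *)
Lemma eigenvalue_coincidence_twice l m i j : l != ord0 -> m != ord0 ->
  l != m -> i != ord0 -> j != ord0 -> i != j ->
  P l i = P m i -> P l j != P m j.
Proof.
move=> nl nm nlm ni nj nij hi; apply/eqP => hj.
have [k hk] : exists k : 'I_4, forall r, [|| r == ord0, r == i, r == j | r == k].
  case: i j ni nj nij {hi hj} => [[|[|[|[|//]]]]] ? [[|[|[|[|//]]]]] ? // _ _ _;
    [exists o3|exists o2|exists o3|exists o1|exists o2|exists o1];
    by case=> [[|[|[|[|//]]]]].
have hrest r : r != k -> P l r = P m r.
  move=> nrk; have /or4P[] := hk r; last by rewrite (negPf nrk).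
  - by move=> /eqP ->; rewrite !(eigenmatrix0 hE).
  - by move=> /eqP ->.
  - by move=> /eqP ->.
have /eqP[] := nlm; apply: (eigenmatrix_row_inj hE) => r.
have [->|/hrest //] := eqVneq r k.
have := etrans (eigenmatrix_row_sum hE nl) (esym (eigenmatrix_row_sum hE nm)).
by rewrite (bigD1 k) //= [RHS](bigD1 k) //= (eq_bigr _ hrest) => /addIr.
Qed.

End ThreeClasses.

Theorem theorem3p1 (R : realType) (X : finType) (S : assoc_scheme R X 3)
    (hprim : primitive_scheme S) (hQ : Q_polynomial S) :
  exists i : 'I_4, i != ord0 /\
    has_n_distinct_eigenvalues 4 (intersection_mx S i).
Proof.
case: hQ => E [q [hE hk h0 hn0]].
pose P := eigenmatrix S E.
pose o1 := @Ordinal 4 1 isT; pose o2 := @Ordinal 4 2 isT.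
pose o3 := @Ordinal 4 3 isT.
have n23 i : i != ord0 -> P o2 i != P o3 i.
  exact: eigenvalue_coincidence23_false hk h0 hn0.
have distinct i : i != ord0 -> P o1 i != P o2 i -> P o1 i != P o3 i ->
    has_n_distinct_eigenvalues 4 (intersection_mx S i).
  move=> ni n12 n13.
  apply: (@distinct_eigenvalues _ _ _ [:: P ord0 i; P o1 i; P o2 i; P o3 i]) => //.
    by rewrite /= !inE !negb_or n12 n13 n23 ?(eigenmatrix_primitive hE).
  by rewrite /= !(eigenvalue_intersection_mx hE).
(* These hypotheses are contradictory; the conclusion is the goal itself so that [clash] closes
   every case below. *)
have clash (m i j : 'I_4) : P o1 i = P m i -> P o1 j = P m j ->
    m != ord0 -> o1 != m -> i != ord0 -> j != ord0 -> i != j ->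
    exists r : 'I_4, r != ord0 /\
      has_n_distinct_eigenvalues 4 (intersection_mx S r).
  move=> hi hj nm n1m ni nj nij.
  have /eqP[] : P o1 j != P m j by apply: (eigenvalue_coincidence_twice hE) hi.
  exact: hj.
have [d1|] := boolP ((P o1 o1 != P o2 o1) && (P o1 o1 != P o3 o1)).
  by exists o1; case/andP: d1; split=> //; apply: distinct.
have [d2|] := boolP ((P o1 o2 != P o2 o2) && (P o1 o2 != P o3 o2)).
  by exists o2; case/andP: d2; split=> //; apply: distinct.
have [d3|] := boolP ((P o1 o3 != P o2 o3) && (P o1 o3 != P o3 o3)).
  by exists o3; case/andP: d3; split=> //; apply: distinct.
(* In each of the columns 1, 2, 3, row 1 now meets row 2 or row 3, so two columns share the same
   row. *)
rewrite !negb_and !negbK => /orP h3 /orP h2 /orP h1.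
by case: h1 => /eqP h1; case: h2 => /eqP h2; case: h3 => /eqP h3;
   solve [exact: (clash _ _ _ h1 h2) | exact: (clash _ _ _ h1 h3)
         | exact: (clash _ _ _ h2 h3)].
Qed.
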